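(* Let $\mathbf{A}\in\mathbb{R}^{n\times d}$ have nonzero rows $a_1,\dots,a_n$, $\mathbf{\Sigma}=\mathbf{A}^\top\mathbf{A}$ with eigenvalues $\lambda_1\ge\lambda_2\ge\dots$, $\mathrm{gap}=(\lambda_1-\lambda_2)/\lambda_1>0$, $(1+\frac{\mathrm{gap}}{150})\lambda_1<\lambda\le(1+\frac{\mathrm{gap}}{100})\lambda_1$, $\mathbf{B}=\lambda\mathbf{I}-\mathbf{\Sigma}$, $b\in\mathbb{R}^d$, $f(x)=\frac12x^\top\mathbf{B}x-b^\top x$ with minimizer $x^{*}=\mathbf{B}^{-1}b$. Let $\psi_i(x)=\frac12x^\top\big(\frac{\lambda\|a_i\|_2^2}{\|\mathbf{A}\|_F^2}\mathbf{I}-a_ia_i^\top\big)x-\frac1nb^\top x$, $p_i=\|a_i\|_2^2/\|\mathbf{A}\|_F^2$, $\bar S=\frac{2\lambda_1\|\mathbf{A}\|_F^2}{\lambda-\lambda_1}$, $\mu=\lambda-\lambda_1$, $\eta=1/(8\bar S)$. Starting from $x_0$, run the iteration $x_{k+1}=x_k-\eta\big[\frac1{p_{i_k}}(\nabla\psi_{i_k}(x_k)-\nabla\psi_{i_k}(x_0))+\nabla f(x_0)\big]$ with $i_k$ drawn independently from $p$, and output $x_m$ where $m$ is chosen uniformly at random from $\{1,\dots,\lceil64\bar S/\mu\rceil\}$. Then $$\mathbb{E}\|x_m-x^{*}\|_{\mathbf{B}}^2\le\frac12\|x_0-x^{*}\|_{\mathbf{B}}^2,$$ and the procedure runs in time 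$O\left(\mathrm{nnz}(\mathbf{A})+\frac{d\,\mathrm{sr}(\mathbf{A})}{\mathrm{gap}^2}\right)$.
   Context: $\|y\|_{\mathbf{B}}=\sqrt{y^\top\mathbf{B}y}$. $\mathrm{nnz}(\mathbf{A})$ is the number of nonzero entries of $\mathbf{A}$ and $\mathrm{sr}(\mathbf{A})=\|\mathbf{A}\|_F^2/\|\mathbf{A}\|_2^2$ its stable rank. *)

(* Defs.v *)
(* MathComp with MathComp-Analysis *)
From HB Require Import structures.
From mathcomp Require Export all_boot all_order all_algebra.
From mathcomp Require Export all_classical all_reals all_analysis.

Set Implicit Arguments.
Unset Strict Implicit.
Unset Printing Implicit Defensive.

Export Order.TTheory GRing.Theory Num.Theory.
Export numFieldNormedType.Exports.

Local Open Scope classical_set_scope.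
Local Open Scope ring_scope.

(** ** Matrices and norms *)

Definition norm2 (R : realType) (d : nat) (v : 'cV[R]_d) : R :=
  Num.sqrt (\sum_j v j 0 ^+ 2).

Definition normF (R : realType) (n d : nat) (A : 'M[R]_(n, d)) : R :=
  Num.sqrt (\sum_i \sum_j A i j ^+ 2).

Definition opnorm2 (R : realType) (n d : nat) (A : 'M[R]_(n, d)) : R :=
  sup [set norm2 (A *m x) | x in [set x : 'cV[R]_d | norm2 x = 1]].

Definition qform (R : realType) (d : nat) (B : 'M[R]_d) (y : 'cV[R]_d) : R :=
  (y^T *m B *m y) 0 0.

Definition normB (R : realType) (d : nat) (B : 'M[R]_d) (y : 'cV[R]_d) : R :=
  Num.sqrt (qform B y).

Definition dotv (R : realType) (d : nat) (u v : 'cV[R]_d) : R :=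
  (u^T *m v) 0 0.

Definition nnz (R : realType) (n d : nat) (A : 'M[R]_(n, d)) : nat :=
  #|[pred ij : 'I_n * 'I_d | A ij.1 ij.2 != 0]|.

Definition srank (R : realType) (n d : nat) (A : 'M[R]_(n, d)) : R :=
  normF A ^+ 2 / opnorm2 A ^+ 2.

Definition arow (R : realType) (n d : nat) (A : 'M[R]_(n, d)) (i : 'I_n) :
  'cV[R]_d := (row i A)^T.

Definition Sigma (R : realType) (n d : nat) (A : 'M[R]_(n, d)) : 'M[R]_d :=
  A^T *m A.

(** [s] lists all eigenvalues of [M], with multiplicity, in nonincreasing
    order; 0-based, so the k-th eigenvalue is [s`_k.-1]. *)
Definition eigenvalues_desc (R : realType) (d : nat) (M : 'M[R]_d)
    (s : seq R) : Prop :=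
  sorted >=%R s /\ char_poly M = \prod_(l <- s) ('X - l%:P).

Definition gap (R : realType) (l1 l2 : R) : R := (l1 - l2) / l1.

Definition grad (R : realType) (d : nat) (f : 'cV[R]_d -> R) (x : 'cV[R]_d) :
  'cV[R]_d := \col_j 'D_(delta_mx j 0) f x.

(** ** The objective and the iteration *)

Definition Bmx (R : realType) (n d : nat) (A : 'M[R]_(n, d)) (lam : R) :
  'M[R]_d := lam%:M - Sigma A.

Definition fobj (R : realType) (n d : nat) (A : 'M[R]_(n, d)) (lam : R)
    (b x : 'cV[R]_d) : R :=
  2^-1 * qform (Bmx A lam) x - dotv b x.

Definition psi (R : realType) (n d : nat) (A : 'M[R]_(n, d)) (lam : R)
    (b : 'cV[R]_d) (i : 'I_n) (x : 'cV[R]_d) : R :=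
  2^-1 * qform ((lam * norm2 (arow A i) ^+ 2 / normF A ^+ 2)%:M
                - arow A i *m (arow A i)^T) x
  - n%:R^-1 * dotv b x.

Definition xstar (R : realType) (n d : nat) (A : 'M[R]_(n, d)) (lam : R)
    (b : 'cV[R]_d) : 'cV[R]_d := invmx (Bmx A lam) *m b.

Definition prow (R : realType) (n d : nat) (A : 'M[R]_(n, d)) (i : 'I_n) : R :=
  norm2 (arow A i) ^+ 2 / normF A ^+ 2.

Definition Sbar (R : realType) (n d : nat) (A : 'M[R]_(n, d)) (l1 lam : R) : R :=
  2 * l1 * normF A ^+ 2 / (lam - l1).

Definition eta (R : realType) (n d : nat) (A : 'M[R]_(n, d)) (l1 lam : R) : R :=
  (8 * Sbar A l1 lam)^-1.

(** The ceiling is an [int]; it is nonnegative whenever [l1 < lam], [0 <= l1]. *)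
Definition nsteps (R : realType) (n d : nat) (A : 'M[R]_(n, d)) (l1 lam : R) :
  nat := `|Num.ceil (64 * Sbar A l1 lam / (lam - l1))|%N.

Definition svrg_step (R : realType) (n d : nat) (A : 'M[R]_(n, d))
    (l1 lam : R) (b x0 x : 'cV[R]_d) (i : 'I_n) : 'cV[R]_d :=
  x - eta A l1 lam *:
    ((prow A i)^-1 *: (grad (psi A lam b i) x - grad (psi A lam b i) x0)
     + grad (fobj A lam b) x0).

(** [x_k] when the drawn indices are [i_0, i_1, ...] = [w]. *)
Definition svrg_iter (R : realType) (n d : nat) (A : 'M[R]_(n, d))
    (l1 lam : R) (b x0 : 'cV[R]_d) (w : seq 'I_n) (k : nat) : 'cV[R]_d :=
  foldl (svrg_step A l1 lam b x0) x0 (take k w).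

(** Expectation of [g x_m] under the product of the law [prow A] on
    [i_0, ..., i_(M-1)] and the uniform law of [m] on {1, ..., M}. *)
Definition svrg_expect (R : realType) (n d : nat) (A : 'M[R]_(n, d))
    (l1 lam : R) (b x0 : 'cV[R]_d) (g : 'cV[R]_d -> R) : R :=
  let M := nsteps A l1 lam in
  \sum_(w : M.-tuple 'I_n) \sum_(1 <= m < M.+1)
    (\prod_(i <- w) prow A i) * M%:R^-1 * g (svrg_iter A l1 lam b x0 w m).

(** ** A unit-cost randomized real RAM

    [prog R X] is a randomized computation returning an [X]: [Tick] is one
    elementary operation, [Draw w k] draws an index [i] with probability [w i],
    independently of everything drawn before, and continues as [k i]. *)
Inductive prog (R : Type) (X : Type) : Type :=
| Ret of X
| Tick of prog R X
| Draw (N : nat) of ('I_N -> R) & ('I_N -> prog R X).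

Arguments Ret {R X}.
Arguments Draw {R X N}.

Fixpoint bind (R X Y : Type) (p : prog R X) (k : X -> prog R Y) : prog R Y :=
  match p with
  | Ret x => k x
  | Tick q => Tick (bind q k)
  | Draw N w q => Draw w (fun i => bind (q i) k)
  end.

Notation "'let*' x := p 'in' q" := (bind p (fun x => q))
  (at level 200, x name, p at level 200, q at level 200,
   format "'[v' 'let*'  x  :=  p  'in' '/' q ']'").

(** Worst-case number of operations, over all outcomes of the draws. *)
Fixpoint time (R X : Type) (p : prog R X) : nat :=
  match p with
  | Ret _ => 0
  | Tick q => (time q).+1
  | Draw N _ q => (\max_(i < N) time (q i)).+1
  end.

Fixpoint expect (R : realType) (X : Type) (g : X -> R) (p : prog R X) : R :=
  match p with
  | Ret x => g x
  | Tick q => expect g q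
  | Draw N w q => \sum_(i < N) w i * expect g (q i)
  end.

Definition op (R X : Type) (x : X) : prog R X := Tick (Ret x).
Definition addP (R : realType) (x y : R) : prog R R := op R (x + y).
Definition subP (R : realType) (x y : R) : prog R R := op R (x - y).
Definition mulP (R : realType) (x y : R) : prog R R := op R (x * y).
Definition divP (R : realType) (x y : R) : prog R R := op R (x / y).

(** Vectors are arrays with unit-cost access.  Charging one operation for
    [writeP] is legitimate because the programs below never use the old
    version of an array again after writing to it. *)
Definition readP (R : realType) (d : nat) (v : 'cV[R]_d) (j : 'I_d) :
  prog R R := op R (v j 0).
Definition writeP (R : realType) (d : nat) (v : 'cV[R]_d) (j : 'I_d) (c : R) :
  prog R 'cV[R]_d := op R (\col_k (if k == j then c else v k 0)).

(** Loops pay one operation per iteration in addition to their body. *)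
Fixpoint foldP (R T X : Type) (f : X -> T -> prog R X) (s : seq T) (x : X) :
  prog R X :=
  match s with
  | [::] => Ret x
  | t :: s' => Tick (let* y := f x t in foldP f s' y)
  end.

Fixpoint repeatP (R X : Type) (f : X -> prog R X) (k : nat) (x : X) :
  prog R X :=
  match k with
  | 0 => Ret x
  | k'.+1 => Tick (let* y := f x in repeatP f k' y)
  end.

Definition fillP (R : realType) (d : nat) (f : 'I_d -> prog R R) :
  prog R 'cV[R]_d :=
  foldP (fun v j => let* c := f j in writeP v j c) (enum 'I_d) 0.

(** The ceiling is not a primitive: it is charged as a linear search. *)
Definition ceilP (R : realType) (x : R) : prog R nat :=
  let M := `|Num.ceil x|%N in iter M.+1 (@Tick R nat) (Ret M).

Definition uniformP (R : realType) (M : nat) : prog R 'I_M :=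
  Draw (fun _ => M%:R^-1) (fun i => Ret i).

(** Sampling from an explicit law on [n] points: [n] operations of
    preprocessing (alias table), and then one operation per draw. *)
Definition prepareP (R : realType) (n : nat) (p : 'cV[R]_n) :
  prog R 'cV[R]_n := iter n (@Tick R 'cV[R]_n) (Ret p).
Definition sampleP (R : realType) (n : nat) (p : 'cV[R]_n) : prog R 'I_n :=
  Draw (fun i => p i 0) (fun i => Ret i).

(** Input format of [A]: for each row, the list of its nonzero entries. *)
Definition sprow (R : realType) (n d : nat) (A : 'M[R]_(n, d)) (i : 'I_n) :
  seq ('I_d * R) :=
  [seq (j, A i j) | j <- enum 'I_d & A i j != 0].

Definition spdotP (R : realType) (d : nat) (s : seq ('I_d * R))
    (u : 'cV[R]_d) : prog R R :=
  foldP (fun c e => let* y := readP u e.1 in let* z := mulP e.2 y in addP c z) s 0.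

(** [v - c * s] *)
Definition spsubP (R : realType) (d : nat) (c : R) (s : seq ('I_d * R))
    (v : 'cV[R]_d) : prog R 'cV[R]_d :=
  foldP (fun v e =>
    let* z := mulP c e.2 in let* y := readP v e.1 in let* t := subP y z in
    writeP v e.1 t) s v.

(** [lam x0 - b - sum_i a_i (a_i . x0)], the gradient of [fobj] at [x0] *)
Definition fgradP (R : realType) (n d : nat) (rows : 'I_n -> seq ('I_d * R))
    (lam : R) (b x0 : 'cV[R]_d) : prog R 'cV[R]_d :=
  let* g := fillP (fun j =>
    let* x := readP x0 j in let* y := mulP lam x in let* z := readP b j in subP y z) in
  foldP (fun g i => let* c := spdotP (rows i) x0 in spsubP c (rows i) g)
    (enum 'I_n) g.

(** One iteration, using that [(grad psi_i x - grad psi_i x0) / p_i] is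
    [lam (x - x0) - (a_i . (x - x0) / p_i) a_i]. *)
Definition stepP (R : realType) (n d : nat) (rows : 'I_n -> seq ('I_d * R))
    (lam : R) (x0 : 'cV[R]_d) (p : 'cV[R]_n) (h : R) (g x : 'cV[R]_d) :
  prog R 'cV[R]_d :=
  let* i := sampleP p in
  let* u := fillP (fun j => let* y := readP x j in let* z := readP x0 j in subP y z) in
  let* c := spdotP (rows i) u in
  let* q := readP p i in
  let* c' := divP c q in
  let* v := fillP (fun j =>
    let* y := readP u j in let* t := mulP lam y in let* z := readP g j in addP t z) in
  let* v' := spsubP c' (rows i) v in
  fillP (fun j =>
    let* y := readP v' j in let* t := mulP h y in let* z := readP x j in subP z t).

Definition svrgP (R : realType) (n d : nat) (rows : 'I_n -> seq ('I_d * R))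
    (l1 lam : R) (b x0 : 'cV[R]_d) : prog R 'cV[R]_d :=
  let* rho := fillP (fun i =>
    foldP (fun c e => let* z := mulP e.2 e.2 in addP c z) (rows i) 0) in
  let* F := foldP (fun c i => let* r := readP rho i in addP c r) (enum 'I_n) 0 in
  let* p := fillP (fun i => let* r := readP rho i in divP r F) in
  let* p' := prepareP p in
  let* mu := subP lam l1 in
  let* s1 := mulP 2 l1 in
  let* s2 := mulP s1 F in
  let* S := divP s2 mu in
  let* e := mulP 8 S in
  let* h := divP 1 e in
  let* t := mulP 64 S in
  let* t' := divP t mu in
  let* M := ceilP t' in
  let* g := fgradP rows lam b x0 in
  let* m := uniformP R M in
  repeatP (stepP rows lam x0 p' h g) m.+1 x0.

(* Main.v *)
(* Let [w = x - x*] and [w0 = x0 - x*]. A step moves along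
   [g_i = M_i w - (M_i w0 - B w0)], where [M_i = lam I - a_i a_i^T / p_i] has
   mean [B] under [p]. The second moment of [M_i z] is computed exactly,
   [lam^2 |z|^2 + (|A|_F^2 - 2 lam) z . Sigma z], and is at most
   [Sbar |z|_B^2] although the individual [psi_i] are not convex. With
   [eta = 1 / (8 Sbar)] this gives
     [E |w'|^2 + (7/4) eta |w|_B^2 <= |w|^2 + (eta/4) |w0|_B^2],
   which is summed over the steps, using [|w0|^2 <= |w0|_B^2 / mu]. For the
   running time, every deterministic part of the program equals a number of
   ticks followed by its result, a step costs O(d), and
   [M = O(l1 |A|_F^2 / mu^2) = O(sr(A) / gap^2)]. *)
From mathcomp Require Import ring lra zify.
Require Import Defs.

Set Implicit Arguments.
Unset Strict Implicit.
Unset Printing Implicit Defensive.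

Local Open Scope classical_set_scope.
Local Open Scope ring_scope.

(** * Quadratic forms and the largest eigenvalue *)

Section Dot.
Variables (R : realType) (d : nat).
Implicit Types (u v w x y : 'cV[R]_d) (P : 'M[R]_d).

Lemma dotvE u v : dotv u v = \sum_j u j 0 * v j 0.
Proof. by rewrite /dotv mxE; apply: eq_bigr => j _; rewrite mxE. Qed.

Lemma dotvC u v : dotv u v = dotv v u.
Proof. by rewrite !dotvE; apply: eq_bigr => j _; rewrite mulrC. Qed.

Lemma dotvDr u v w : dotv u (v + w) = dotv u v + dotv u w.
Proof. by rewrite /dotv mulmxDr mxE. Qed.

Lemma dotvZr (c : R) u v : dotv u (c *: v) = c * dotv u v.
Proof. by rewrite /dotv -scalemxAr mxE. Qed.

Lemma dotvNr u v : dotv u (- v) = - dotv u v.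
Proof. by rewrite /dotv mulmxN mxE. Qed.

Lemma dotvBr u v w : dotv u (v - w) = dotv u v - dotv u w.
Proof. by rewrite dotvDr dotvNr. Qed.

Lemma dotvDl u v w : dotv (v + w) u = dotv v u + dotv w u.
Proof. by rewrite dotvC dotvDr !(dotvC u). Qed.

Lemma dotvZl (c : R) u v : dotv (c *: v) u = c * dotv v u.
Proof. by rewrite dotvC dotvZr dotvC. Qed.

Lemma dotvBl u v w : dotv (v - w) u = dotv v u - dotv w u.
Proof. by rewrite dotvC dotvBr !(dotvC u). Qed.

Lemma dotv_subZ (c : R) u v :
  dotv (u - c *: v) (u - c *: v)
  = dotv u u - 2 * c * dotv u v + c ^+ 2 * dotv v v.
Proof. by rewrite !(dotvBl, dotvBr, dotvZl, dotvZr) (dotvC v u); ring. Qed.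

Lemma dotv_sumr (I : finType) u (F : I -> 'cV[R]_d) :
  dotv u (\sum_i F i) = \sum_i dotv u (F i).
Proof. by rewrite /dotv mulmx_sumr summxE. Qed.

Lemma dotvv_ge0 u : 0 <= dotv u u.
Proof. by rewrite dotvE sumr_ge0 // => j _; rewrite -expr2 sqr_ge0. Qed.

Lemma dotvv_eq0 u : (dotv u u == 0) = (u == 0).
Proof.
rewrite dotvE psumr_eq0; last by move=> j _; rewrite -expr2 sqr_ge0.
apply/allP/eqP => [u0|-> j _]; last by rewrite mxE mulr0 eqxx implybT.
apply/matrixP => j k; rewrite ord1 mxE.
by have := u0 j (mem_index_enum j); rewrite /= -expr2 sqrf_eq0 => /eqP.
Qed.

Lemma dotvv_gt0 u : u != 0 -> 0 < dotv u u.
Proof. by move=> u0; rewrite lt_def dotvv_eq0 u0 dotvv_ge0. Qed.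

Lemma norm2_sq u : norm2 u ^+ 2 = dotv u u.
Proof.
rewrite dotvE /norm2 sqr_sqrtr; last by apply: sumr_ge0 => j _; rewrite sqr_ge0.
by apply: eq_bigr => j _; rewrite expr2.
Qed.

Lemma norm2_sqrt u : norm2 u = Num.sqrt (dotv u u).
Proof. by rewrite -norm2_sq sqrtr_sqr ger0_norm // sqrtr_ge0. Qed.

Lemma qformE P x : qform P x = dotv x (P *m x).
Proof. by rewrite /qform /dotv mulmxA. Qed.

Lemma dotv_trmx (n : nat) (M : 'M[R]_(n, d)) (u : 'cV[R]_n) v :
  dotv u (M *m v) = dotv (M^T *m u) v.
Proof. by rewrite /dotv trmx_mul trmxK mulmxA. Qed.

Lemma dotv_sym P u v : P^T = P -> dotv u (P *m v) = dotv v (P *m u).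
Proof. by move=> sP; rewrite dotv_trmx sP dotvC. Qed.

Lemma qform_lin P (a c : R) x y : P^T = P ->
  qform P (a *: x + c *: y) =
  a ^+ 2 * qform P x + 2 * a * c * dotv x (P *m y) + c ^+ 2 * qform P y.
Proof.
move=> sP; rewrite !qformE mulmxDr -!scalemxAr !(dotvDl, dotvDr, dotvZl, dotvZr).
by rewrite (dotv_sym y x sP); ring.
Qed.

(** Nonnegativity of the form is tested at a single combination of [x] and [y]. Since [P] may be
    degenerate, the case [qform P y = 0] is treated apart. *)
Lemma psd_cauchy_schwarz P x y : P^T = P -> (forall z, 0 <= qform P z) ->
  dotv x (P *m y) ^+ 2 <= qform P x * qform P y.
Proof.
move=> sP pP; set a := qform P y; set b := dotv x _; set c := qform P x.
have [a0|a0] := eqVneq a 0.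
  rewrite a0 mulr0; have [->|b0] := eqVneq b 0; first by rewrite expr0n.
  (* The form vanishes at [y], so at [x + t y] it equals [c + 2 t b]; this [t] would make it -1. *)
  have := pP (1 *: x + (- (c + 1) / (2 * b)) *: y).
  rewrite qform_lin // -/a -/b -/c a0.
  have -> : 1 ^+ 2 * c + 2 * 1 * (- (c + 1) / (2 * b)) * b
            + (- (c + 1) / (2 * b)) ^+ 2 * 0 = -1 by field.
  by rewrite ler0N1.
have a_gt0 : 0 < a by rewrite lt_def a0 pP.
(* Up to the factor [a], this is the residual of the [P]-orthogonal projection of [x] onto [y]. *)
have := pP (a *: x + (- b) *: y); rewrite qform_lin // -/a -/b -/c.
rewrite (_ : _ + _ = a * (c * a - b ^+ 2)); last by ring.
by rewrite pmulr_rge0 // subr_ge0.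
Qed.

Lemma cauchy_schwarz x y : dotv x y ^+ 2 <= dotv x x * dotv y y.
Proof.
have := @psd_cauchy_schwarz 1%:M x y; rewrite !qformE !mul1mx; apply.
  by rewrite trmx1.
by move=> z; rewrite qformE mul1mx dotvv_ge0.
Qed.

(** Follows from [2 |x_i x_j| <= x_i^2 + x_j^2 <= 2 |x|^2]. The bound is crude, but it makes the
    Rayleigh quotients of a matrix and of an inverse bounded. *)
Lemma qform_ub P x : qform P x <= (\sum_i \sum_j `|P i j|) * dotv x x.
Proof.
have sq_le i : x i 0 ^+ 2 <= dotv x x.
  rewrite dotvE (bigD1 i) //= expr2 lerDl sumr_ge0 // => j _.
  by rewrite -expr2 sqr_ge0.
rewrite qformE dotvE mulr_suml ler_sum // => i _.
rewrite mxE mulr_suml mulr_sumr ler_sum // => j _.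
rewrite (le_trans (ler_norm _)) // mulrCA normrM ler_wpM2l //.
have xi := sq_le i; have xj := sq_le j.
have : 0 <= (`|x i 0| - `|x j 0|) ^+ 2 by rewrite sqr_ge0.
by rewrite normrM sqrrB !real_normK ?num_real //; lra.
Qed.

Lemma normB_sq P x : 0 <= qform P x -> normB P x ^+ 2 = qform P x.
Proof. by move=> ?; rewrite /normB sqr_sqrtr. Qed.

End Dot.

Section Spectrum.
Variables (R : realType) (d : nat).
Implicit Types (P : 'M[R]_d) (x : 'cV[R]_d).

Lemma eigenvalue_colP P (a : R) : P^T = P -> eigenvalue P a ->
  exists2 v : 'cV[R]_d, P *m v = a *: v & v != 0.
Proof.
move=> sP /eigenvalueP[v vP v0]; exists v^T; last by rewrite trmx_eq0.
by rewrite -[in LHS]sP -trmx_mul vP linearZ.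
Qed.

(** The determinant of [a%:M - P] is the characteristic polynomial evaluated at [a]. *)
Lemma unitmx_not_eigenvalue P (a : R) : ~~ eigenvalue P a -> a%:M - P \in unitmx.
Proof.
rewrite eigenvalue_root_char rootE unitmxE unitfE; congr (_ != _).
rewrite /char_poly -horner_evalE -det_map_mx; congr (\det _).
apply/matrixP => i j; rewrite !mxE /= horner_evalE hornerD hornerN hornerC.
by rewrite hornerMn hornerX.
Qed.

(* The supremum L of the Rayleigh quotient is an eigenvalue: otherwise
   Q := L - P would be positive semidefinite and invertible, and
   Cauchy-Schwarz for Q, |x|^4 <= (x . Q x) (Q^-1 x . x), would bound x . Q x
   away from 0 on the unit sphere. *)
Lemma qform_le_max_eigenvalue P (l : R) x : P^T = P ->
  (forall a, eigenvalue P a -> a <= l) -> qform P x <= l * dotv x x.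
Proof.
move=> sP maxl.
have [->|x0] := eqVneq x 0.
  by rewrite qformE mulmx0 !dotvE !big1 ?mulr0 // => j _; rewrite !mxE mulr0.
pose E := [set qform P y | y in [set y | dotv y y = 1]].
have scal (y : 'cV[R]_d) : y != 0 -> exists2 c : R, 0 < c & dotv (c *: y) (c *: y) = 1.
  move=> /dotvv_gt0 y0; exists (Num.sqrt (dotv y y))^-1.
    by rewrite invr_gt0 sqrtr_gt0.
  rewrite dotvZl dotvZr mulrA -expr2 exprVn sqr_sqrtr ?mulVf ?gt_eqF //.
  exact: ltW.
have qZ (c : R) y : qform P (c *: y) = c ^+ 2 * qform P y.
  by rewrite !qformE -scalemxAr dotvZl dotvZr mulrA expr2.
have ubE : ubound E (\sum_i \sum_j `|P i j|).
  by move=> _ [y /= y1 <-]; have := qform_ub P y; rewrite y1 mulr1.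
have supE : has_sup E.
  split; last by exists (\sum_i \sum_j `|P i j|).
  by have [c _ c1] := scal _ x0; exists (qform P (c *: x)), (c *: x).
set L := sup E.
have leL y : qform P y <= L * dotv y y.
  have [->|y0] := eqVneq y 0.
    by rewrite qformE mulmx0 !dotvE !big1 ?mulr0 // => j _; rewrite !mxE mulr0.
  have [c c0 c1] := scal _ y0.
  have : qform P (c *: y) <= L by apply: ub_le_sup; [case: supE|exists (c *: y)].
  rewrite qZ -[leRHS]mulr1 -c1 dotvZl dotvZr.
  rewrite (_ : L * (c * _) = c ^+ 2 * (L * dotv y y)); last by ring.
  by rewrite (ler_pM2l (exprn_gt0 2 c0)).
apply: (le_trans (leL x)); rewrite ler_wpM2r ?dotvv_ge0 //; apply: maxl.
apply: contraT => /unitmx_not_eigenvalue; set Q := _ - P => uQ.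
have sQ : Q^T = Q by rewrite /Q linearB /= tr_scalar_mx sP.
have qQ y : qform Q y = L * dotv y y - qform P y.
  by rewrite !qformE /Q mulmxBl dotvBr mul_scalar_mx dotvZr.
have pQ y : 0 <= qform Q y by rewrite qQ subr_ge0.
pose K := (\sum_i \sum_j `|invmx Q i j|) + 1.
have K0 : 0 < K.
  by rewrite ltr_pwDr // sumr_ge0 // => i _; rewrite sumr_ge0.
suff : L <= L - K^-1 by rewrite lerBrDl gerDr leNgt invr_gt0 K0.
apply: ge_sup; first by case: supE.
move=> _ [y /= y1 <-].
have := psd_cauchy_schwarz y (invmx Q *m y) sQ pQ.
rewrite (mulmxA Q) mulmxV // mul1mx y1 expr1n qQ y1 mulr1.
rewrite (qformE Q) mulmxA mulmxV // mul1mx dotvC -qformE => le1.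
have leK : qform (invmx Q) y <= K.
  by have := qform_ub (invmx Q) y; rewrite y1 mulr1 /K; lra.
have : 1 <= (L - qform P y) * K.
  apply: (le_trans le1); rewrite ler_wpM2l //.
  by have := leL y; rewrite y1 mulr1 subr_ge0.
by rewrite -ler_pdivrMr // div1r; lra.
Qed.

Lemma eigenvalues_desc_mem P s (a : R) :
  eigenvalues_desc P s -> eigenvalue P a = (a \in s).
Proof. by case=> _ cP; rewrite eigenvalue_root_char cP root_prod_XsubC. Qed.

Lemma eigenvalues_desc_size P s : eigenvalues_desc P s -> size s = d.
Proof.
by case=> _ cP; apply: succn_inj; rewrite -(size_char_poly P) cP size_prod_XsubC.
Qed.

Lemma eigenvalues_desc_max P s (a : R) :
  eigenvalues_desc P s -> eigenvalue P a -> a <= s`_0.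
Proof.
move=> sP; rewrite (eigenvalues_desc_mem _ sP); case: sP => + _.
case: s => //= x s /order_path_min; move/(_ ge_trans)/allP => xs.
by rewrite inE => /predU1P[->//|/xs].
Qed.

End Spectrum.

(** * Gradients and the rows of A *)

Section Gradients.
Variables (R : realType) (d : nat).
Implicit Types (P : 'M[R]_d) (b x v : 'cV[R]_d).

(** For [h != 0] the difference quotient is the affine function [a + h * e] of the increment, so it
    tends to [a]; symmetry of [P] merges the two cross terms. *)
Lemma derive_quadratic P (c : R) b x v : P^T = P ->
  'D_v (fun y => 2^-1 * qform P y - c * dotv b y) x
  = dotv v (P *m x) - c * dotv b v.
Proof.
move=> sP; rewrite /derive; apply: cvg_lim => //.
pose a := dotv v (P *m x) - c * dotv b v; rewrite -/a; pose e := 2^-1 * qform P v.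
have affine_cvg : (fun h : R => a + h * e) @ 0^' --> a.
  have : (fun h : R => a + h * e) @ 0 --> a + 0 * e.
    by apply: cvgD; [exact: cvg_cst|apply: cvgMl; exact: cvg_id].
  rewrite mul0r addr0; apply: cvg_trans; apply: cvg_app; exact: nbhs_dnbhs.
apply: (cvg_trans _ affine_cvg); apply: near_eq_cvg; near=> h.
have h0 : h != 0 by near: h; exact: nbhs_dnbhs_neq.
rewrite /= -[x in _ *: v + x]scale1r qform_lin // dotvDr !dotvZr.
by rewrite /e /a /GRing.scale /=; field.
Unshelve. all: by end_near.
Qed.

Lemma grad_quadratic P (c : R) b x : P^T = P ->
  grad (fun y => 2^-1 * qform P y - c * dotv b y) x = P *m x - c *: b.
Proof.
move=> sP; apply/matrixP => j k; rewrite ord1 mxE derive_quadratic // !mxE.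
have dot_delta w : dotv (delta_mx j 0) w = w j 0.
  rewrite dotvE (bigD1 j) //= big1 ?addr0 => [|i /negPf ij].
    by rewrite mxE !eqxx mul1r.
  by rewrite mxE ij mul0r.
by rewrite (dotvC b) !dot_delta mxE.
Qed.

End Gradients.

(** * Rows of [A] and moments of the importance-weighted gradients *)

Section Rows.
Variables (R : realType) (n d : nat) (A : 'M[R]_(n, d)).
Implicit Types x : 'cV[R]_d.
Local Notation a := (arow A).

Lemma dotv_arow i x : dotv (a i) x = (A *m x) i 0.
Proof. by rewrite dotvE mxE; apply: eq_bigr => j _; rewrite !mxE. Qed.

Lemma normF_sq : normF A ^+ 2 = \sum_i dotv (a i) (a i).
Proof.
rewrite /normF sqr_sqrtr.
  by apply: eq_bigr => i _; rewrite dotvE; apply: eq_bigr => j _; rewrite !mxE expr2.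
by apply: sumr_ge0 => i _; apply: sumr_ge0 => j _; rewrite sqr_ge0.
Qed.

Lemma Sigma_sym : (Sigma A)^T = Sigma A.
Proof. by rewrite /Sigma trmx_mul trmxK. Qed.

Lemma Bmx_sym lam : (Bmx A lam)^T = Bmx A lam.
Proof. by rewrite /Bmx linearB /= tr_scalar_mx Sigma_sym. Qed.

Lemma Sigma_mul x : Sigma A *m x = \sum_i dotv (a i) x *: a i.
Proof.
apply/matrixP => j k; rewrite ord1 summxE /Sigma -mulmxA mxE.
by apply: eq_bigr => i _; rewrite dotv_arow !mxE mulrC.
Qed.

Lemma Bmx_mul lam x : Bmx A lam *m x = lam *: x - Sigma A *m x.
Proof. by rewrite /Bmx mulmxBl mul_scalar_mx. Qed.

Lemma qform_Sigma x : qform (Sigma A) x = \sum_i dotv (a i) x ^+ 2.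
Proof.
rewrite qformE Sigma_mul dotv_sumr.
by apply: eq_bigr => i _; rewrite dotvZr dotvC expr2.
Qed.

Lemma qform_Sigma_norm x : qform (Sigma A) x = dotv (A *m x) (A *m x).
Proof. by rewrite qformE /Sigma -mulmxA dotv_trmx trmxK. Qed.

Lemma qform_Sigma_ge0 x : 0 <= qform (Sigma A) x.
Proof. by rewrite qform_Sigma_norm dotvv_ge0. Qed.

Lemma qform_Bmx lam x : qform (Bmx A lam) x = lam * dotv x x - qform (Sigma A) x.
Proof. by rewrite !qformE Bmx_mul dotvBr dotvZr. Qed.

Lemma qform_Sigma_le_normF x : qform (Sigma A) x <= normF A ^+ 2 * dotv x x.
Proof.
rewrite qform_Sigma normF_sq mulr_suml ler_sum // => i _; exact: cauchy_schwarz.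
Qed.

Lemma prowE i : prow A i = dotv (a i) (a i) / normF A ^+ 2.
Proof. by rewrite /prow norm2_sq. Qed.

Lemma prow_ge0 i : 0 <= prow A i.
Proof. by rewrite prowE divr_ge0 ?dotvv_ge0 // sqr_ge0. Qed.

Lemma sum_prow : 0 < normF A ^+ 2 -> \sum_i prow A i = 1.
Proof.
move=> F0; under eq_bigr do rewrite prowE.
by rewrite -mulr_suml -normF_sq divff // gt_eqF.
Qed.

Lemma arow_neq0 i : row i A != 0 -> a i != 0.
Proof. by rewrite /arow trmx_eq0. Qed.

Lemma prow_gt0 i : row i A != 0 -> 0 < normF A ^+ 2 -> 0 < prow A i.
Proof. by move=> r0 F0; rewrite prowE divr_gt0 // dotvv_gt0 // arow_neq0. Qed.

Lemma grad_fobj lam b x : grad (fobj A lam b) x = Bmx A lam *m x - b.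
Proof.
have := grad_quadratic 1 b x (Bmx_sym lam); rewrite scale1r => <-.
suff -> : fobj A lam b = fun y => 2^-1 * qform (Bmx A lam) y - 1 * dotv b y by [].
by apply/funext => y; rewrite /fobj mul1r.
Qed.

Lemma grad_psi lam b i x : grad (psi A lam b i) x =
  (lam * prow A i) *: x - dotv (a i) x *: a i - n%:R^-1 *: b.
Proof.
rewrite grad_quadratic; last first.
  by rewrite linearB /= tr_scalar_mx trmx_mul trmxK.
rewrite mulmxBl mul_scalar_mx /prow mulrA -(mulmxA (a i)).
by rewrite [_^T *m x]mx11_scalar mul_mx_scalar.
Qed.

(* The importance-weighted gradient [(grad psi_i x - grad psi_i y) / p_i]
   as a function of [z = x - y]. *)
Definition sgrad lam i (z : 'cV[R]_d) : 'cV[R]_d :=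
  lam *: z - (dotv (a i) z / prow A i) *: a i.

Lemma sgradB lam i x y : sgrad lam i (x - y) = sgrad lam i x - sgrad lam i y.
Proof.
rewrite /sgrad dotvBr mulrBl !scalerBl scalerBr.
by rewrite !opprD !opprK addrACA.
Qed.

(** The terms in [b / n] cancel between the two gradients of [psi], and dividing by [prow A i] turns
    the shift [lam * prow A i] into [lam]. *)
Lemma svrg_stepE l1 lam b x0 x i : prow A i != 0 ->
  svrg_step A l1 lam b x0 x i
  = x - eta A l1 lam *: (sgrad lam i (x - x0) + (Bmx A lam *m x0 - b)).
Proof.
move=> p0; rewrite /svrg_step grad_fobj !grad_psi.
suff -> : sgrad lam i (x - x0) = (prow A i)^-1 *:
    ((lam * prow A i) *: x - dotv (a i) x *: a i - n%:R^-1 *: b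
     - ((lam * prow A i) *: x0 - dotv (a i) x0 *: a i - n%:R^-1 *: b)) by [].
rewrite /sgrad dotvBr; move: (dotv _ x) (dotv _ x0) (n%:R^-1) => u v c.
by apply/matrixP => j k; rewrite !mxE; field.
Qed.

(** Averaging undoes the importance weights: [prow A i] cancels its inverse, and the rank-one terms
    add up to [Sigma A]. *)
Lemma mean_sgrad lam x y : 0 < normF A ^+ 2 -> (forall i, row i A != 0) ->
  \sum_i prow A i * dotv y (sgrad lam i x) = dotv y (Bmx A lam *m x).
Proof.
move=> F0 r0; rewrite Bmx_mul Sigma_mul dotvBr dotv_sumr dotvZr.
rewrite -[lam * _]mul1r -(sum_prow F0) mulr_suml -sumrB.
apply: eq_bigr => i _; rewrite /sgrad dotvBr !dotvZr.
by field; rewrite gt_eqF // prow_gt0.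
Qed.

(** Sampling proportionally to squared row norms makes the quadratic term of row [i] equal to
    [|A|_F^2 (a_i . x)^2], so the sum over rows is again a form in [Sigma A]. *)
Lemma mean_sq_sgrad lam x : 0 < normF A ^+ 2 -> (forall i, row i A != 0) ->
  \sum_i prow A i * dotv (sgrad lam i x) (sgrad lam i x)
  = lam ^+ 2 * dotv x x + (normF A ^+ 2 - 2 * lam) * qform (Sigma A) x.
Proof.
move=> F0 r0.
have -> : lam ^+ 2 * dotv x x = \sum_i prow A i * (lam ^+ 2 * dotv x x).
  by rewrite -mulr_suml sum_prow // mul1r.
rewrite qform_Sigma mulr_sumr -big_split /=.
apply: eq_bigr => i _; rewrite /sgrad !(dotvBl, dotvBr, dotvZl, dotvZr).
have ai0 : dotv (a i) (a i) != 0 by rewrite dotvv_eq0 arow_neq0.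
rewrite (dotvC x (a i)) !prowE; field.
by rewrite ai0 andbT; move: F0; rewrite lt_def sqrf_eq0 => /andP[].
Qed.

End Rows.

(** * Convergence *)

Section Averaging.
Variables (R : realType) (n : nat) (p : 'I_n -> R) (X : Type).
Variable step : X -> 'I_n -> X.
Hypotheses (p_ge0 : forall i, 0 <= p i) (p_sum1 : \sum_i p i = 1).

(* The Markov operator of the chain that moves from x to [step x i] with
   probability [p i]. *)
Definition avg (g : X -> R) (x : X) : R := \sum_i p i * g (step x i).

Lemma ler_avg f g x : (forall y, f y <= g y) -> avg f x <= avg g x.
Proof. by move=> fg; apply: ler_sum => i _; rewrite ler_wpM2l. Qed.

Lemma iter_avg_ge0 k g x : (forall y, 0 <= g y) -> 0 <= iter k avg g x.
Proof.
move=> g0; elim: k x => [|k IH] x //=.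
by apply: sumr_ge0 => i _; rewrite mulr_ge0.
Qed.

Lemma avgD f g x : avg (fun y => f y + g y) x = avg f x + avg g x.
Proof. by rewrite /avg -big_split; apply: eq_bigr => i _; rewrite mulrDr. Qed.

Lemma avg_cst (c : R) x : avg (fun=> c) x = c.
Proof. by rewrite /avg -mulr_suml p_sum1 mul1r. Qed.

Lemma avgZ (c : R) f x : avg (fun y => c * f y) x = c * avg f x.
Proof. by rewrite /avg mulr_sumr; apply: eq_bigr => i _; rewrite mulrCA. Qed.

Lemma avg_sum (I : Type) (r : seq I) (F : I -> X -> R) x :
  avg (fun y => \sum_(j <- r) F j y) x = \sum_(j <- r) avg (F j) x.
Proof.
by rewrite /avg exchange_big /=; apply: eq_bigr => i _; rewrite mulr_sumr.
Qed.

(** The induction conditions on the first step: the hypothesis is used at the random point reached,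
    averaged, and added to the drift inequality at [x]. *)
Lemma telescope_avg (V Q : X -> R) (c e : R) (k : nat) x :
  (forall y, avg V y + c * Q y <= V y + e) ->
  iter k avg V x + c * (\sum_(0 <= j < k) iter j avg Q x) <= V x + k%:R * e.
Proof.
move=> drift; elim: k x => [|k IH] x; first by rewrite big_geq //=; lra.
rewrite big_nat_recl //= [X in c * (_ + X)]big_mkord.
have := ler_avg x (IH); rewrite !avgD avgZ avg_cst avg_sum big_mkord /=.
by have := drift x; rewrite -natr1; lra.
Qed.

Lemma sum_tupleS (N : nat) (F : N.+1.-tuple 'I_n -> R) :
  \sum_w F w = \sum_i \sum_(w : N.-tuple 'I_n) F [tuple of i :: w].
Proof.
rewrite pair_big /= (reindex (fun iw : 'I_n * N.-tuple 'I_n => [tuple of iw.1 :: iw.2])).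
  by apply: eq_bigr => -[].
exists (fun w : N.+1.-tuple 'I_n => (thead w, [tuple of behead w])) => [[i w] _|w _].
  by congr (_, _); apply: val_inj.
by rewrite -tuple_eta.
Qed.

Lemma sum_prod_tuple (N : nat) : \sum_(w : N.-tuple 'I_n) \prod_(i <- w) p i = 1.
Proof.
elim: N => [|N IH].
  rewrite (big_pred1 [tuple]) => [|w]; first by rewrite big_nil.
  by rewrite /= tuple0; apply/esym/eqP.
rewrite sum_tupleS -[RHS]p_sum1; apply: eq_bigr => i _.
under eq_bigr do rewrite big_cons.
by rewrite -mulr_sumr IH mulr1.
Qed.

(** Conditioning on the first draw peels off one [avg]; the draws after the [m]-th do not affect the
    state, and their weights sum to 1. *)
Lemma sum_tuple_foldl (N m : nat) (g : X -> R) x : (m <= N)%N ->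
  \sum_(w : N.-tuple 'I_n) (\prod_(i <- w) p i) * g (foldl step x (take m w))
  = iter m avg g x.
Proof.
elim: N m x => [|N IH] [|m] x //.
- move=> _; under eq_bigr do rewrite take0.
  by rewrite -mulr_suml sum_prod_tuple mul1r.
- move=> _; under eq_bigr do rewrite take0.
  by rewrite -mulr_suml sum_prod_tuple mul1r.
rewrite ltnS => mN; rewrite sum_tupleS [RHS]/= /avg; apply: eq_bigr => i _.
rewrite -/avg -IH // mulr_sumr; apply: eq_bigr => w _.
by rewrite /= big_cons mulrA.
Qed.

End Averaging.

(** * One-step drift of the squared distance and halving of the error *)

Section Convergence.
Variables (R : realType) (n d : nat) (A : 'M[R]_(n, d)) (l1 lam : R).
Variables (b x0 : 'cV[R]_d).
Hypotheses (row_neq0 : forall i, row i A != 0) (l1_gt0 : 0 < l1).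
Hypotheses (l1_lam : l1 < lam) (lam_le : lam <= 2 * l1).
Hypothesis l1_normF : l1 <= normF A ^+ 2.
Hypothesis Sigma_le : forall x, qform (Sigma A) x <= l1 * dotv x x.
Hypothesis B_unit : Bmx A lam \in unitmx.

Local Notation F := (normF A ^+ 2).
Local Notation S := (Sbar A l1 lam).
Local Notation B := (Bmx A lam).
Local Notation h := (eta A l1 lam).
Local Notation xs := (xstar A lam b).
Local Notation step := (svrg_step A l1 lam b x0).

Let F_gt0 : 0 < F. Proof. exact: lt_le_trans l1_normF. Qed.
Let lam_gt0 : 0 < lam. Proof. exact: lt_trans l1_lam. Qed.
Let mu_gt0 : 0 < lam - l1. Proof. by rewrite subr_gt0. Qed.

Lemma Sbar_gt0 : 0 < S.
Proof. by rewrite /Sbar divr_gt0 // mulr_gt0 // mulr_gt0. Qed.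

Lemma eta_gt0 : 0 < h.
Proof. by rewrite /eta invr_gt0 mulr_gt0 // Sbar_gt0. Qed.

Lemma qform_Bmx_ge x : (lam - l1) * dotv x x <= qform B x.
Proof. by rewrite qform_Bmx; have := Sigma_le x; lra. Qed.

Lemma qform_Bmx_ge0 x : 0 <= qform B x.
Proof.
by apply: le_trans (qform_Bmx_ge x); rewrite mulr_ge0 ?dotvv_ge0 // ltW.
Qed.

(* Both sides are affine in [q = x . Sigma x], so it suffices to compare them
   at the end points [q = 0] and [q = l1 |x|^2]. *)
Lemma mean_sq_sgrad_le x :
  \sum_i prow A i * dotv (sgrad A lam i x) (sgrad A lam i x) <= S * qform B x.
Proof.
rewrite mean_sq_sgrad // qform_Bmx.
have := Sigma_le x; have := qform_Sigma_ge0 A x; have := dotvv_ge0 x.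
move: (qform _ x) (dotv x x) => q t t0 q0 qt.
rewrite -subr_ge0.
have -> : S * (lam * t - q) - (lam ^+ 2 * t + (F - 2 * lam) * q)
  = (l1 * t - q) / (l1 * (lam - l1)) * (lam * (2 * l1 * F - lam * (lam - l1)))
    + q / l1 * (l1 * F + l1 ^+ 2 - (lam - l1) ^+ 2).
  by rewrite /Sbar; field; rewrite !gt_eqF.
apply: addr_ge0; apply: mulr_ge0.
- by rewrite divr_ge0 ?mulr_ge0 ?subr_ge0 // ltW.
(* At [q = 0] the claim is [lam * (lam - l1) <= 2 * l1 * F], the product of [lam <= 2 * l1] and
   [lam - l1 <= l1 <= F]. *)
- have mu_le : lam - l1 <= F.
    by apply: (le_trans _ l1_normF); move: lam_le; lra.
  apply: mulr_ge0; first exact: ltW.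
  by rewrite subr_ge0; apply: ler_pM => //; exact: ltW.
- by rewrite divr_ge0 // ltW.
- rewrite -addrA; apply: addr_ge0; first by apply: mulr_ge0; exact: ltW.
  rewrite subr_ge0 ler_pXn2r ?nnegrE //; [|exact: ltW|exact: ltW].
  by move: lam_le; lra.
Qed.

Lemma dotv_sqB_le (u v : 'cV[R]_d) :
  dotv (u - v) (u - v) <= 2 * dotv u u + 2 * dotv v v.
Proof.
have := dotvv_ge0 (u + v).
by rewrite !(dotvBl, dotvBr, dotvDl, dotvDr) (dotvC v u); lra.
Qed.

(** Since [b = B x*], the full gradient at [x0] is [B] applied to the initial error; linearity of
    [sgrad] expresses the rest through errors too. *)
Lemma step_error x i : step x i - xs =
  (x - xs) - h *: (sgrad A lam i (x - xs)
                   - (sgrad A lam i (x0 - xs) - B *m (x0 - xs))).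
Proof.
rewrite svrg_stepE ?gt_eqF ?prow_gt0 // addrAC; congr (_ - _ *: _).
have -> : x - x0 = (x - xs) - (x0 - xs) by rewrite opprB addrA subrK.
have -> : B *m x0 - b = B *m (x0 - xs).
  by rewrite mulmxBr /xstar mulmxA mulmxV // mul1mx.
rewrite sgradB; move: (sgrad _ _ _ (x - xs)) (sgrad _ _ _ (x0 - xs)) (B *m _) => u v w.
by rewrite opprB addrA addrAC.
Qed.

Lemma avg_sq_dist x :
  avg (prow A) step (fun y => dotv (y - xs) (y - xs)) x
    + 7 / 4 * h * qform B (x - xs)
  <= dotv (x - xs) (x - xs) + h / 4 * qform B (x0 - xs).
Proof.
set w := x - xs; set w0 := x0 - xs.
pose sg := sgrad A lam; pose g i := sg i w - (sg i w0 - B *m w0).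
have p0 i : 0 <= prow A i by exact: prow_ge0.
have p1 : \sum_i prow A i = 1 by exact: sum_prow.
have avgE : avg (prow A) step (fun y => dotv (y - xs) (y - xs)) x =
  dotv w w - 2 * h * (\sum_i prow A i * dotv w (g i))
  + h ^+ 2 * (\sum_i prow A i * dotv (g i) (g i)).
  have {1}-> : dotv w w = \sum_i prow A i * dotv w w.
    by rewrite -mulr_suml p1 mul1r.
  rewrite !mulr_sumr -sumrB -big_split /=; apply: eq_bigr => i _.
  by rewrite step_error -/w -/w0 -/(g i) dotv_subZ; ring.
(* The correction at [w0] has mean zero, so the search direction has mean [B w]. *)
have mean_g : \sum_i prow A i * dotv w (g i) = qform B w.
  under eq_bigr do rewrite /g (dotvBr w (sg _ w)) (dotvBr w (sg _ w0)) !mulrBr.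
  rewrite !sumrB !mean_sgrad // -mulr_suml p1 mul1r subrr subr0.
  by rewrite qformE.
(* A variance is at most the second moment. *)
have var_w0 : \sum_i prow A i * dotv (sg i w0 - B *m w0) (sg i w0 - B *m w0)
              <= S * qform B w0.
  apply: le_trans (mean_sq_sgrad_le w0); rewrite -subr_ge0.
  have -> : \sum_i prow A i * dotv (sgrad A lam i w0) (sgrad A lam i w0) -
    \sum_i prow A i * dotv (sg i w0 - B *m w0) (sg i w0 - B *m w0)
    = 2 * (\sum_i prow A i * dotv (B *m w0) (sg i w0))
      - \sum_i prow A i * dotv (B *m w0) (B *m w0).
    rewrite mulr_sumr -!sumrB; apply: eq_bigr => i _.
    rewrite -/(sg i w0); move: (sg i w0) (B *m w0) => y z.
    by rewrite !(dotvBl, dotvBr) (dotvC y z); ring.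
  rewrite mean_sgrad // -mulr_suml p1 mul1r.
  by have := dotvv_ge0 (B *m w0); lra.
have sq_g : \sum_i prow A i * dotv (g i) (g i)
            <= 2 * S * (qform B w + qform B w0).
  apply: (@le_trans _ _ (\sum_i (2 * (prow A i * dotv (sg i w) (sg i w))
     + 2 * (prow A i * dotv (sg i w0 - B *m w0) (sg i w0 - B *m w0))))).
    apply: ler_sum => i _; rewrite !(mulrCA 2) -mulrDr.
    by rewrite ler_wpM2l // dotv_sqB_le.
  rewrite big_split /= -!mulr_sumr.
  by have := mean_sq_sgrad_le w; rewrite -/sg; lra.
rewrite avgE mean_g.
(* With [h = 1 / (8 S)], [2 S h^2 = h / 4]. The cross term [-2 h] plus this [h / 4] leaves the
   [-7/4 h] of the claim. *)
have hS : h ^+ 2 * (2 * S * (qform B w + qform B w0))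
          = h / 4 * (qform B w + qform B w0).
  by rewrite /eta; field; rewrite gt_eqF // Sbar_gt0.
have := ler_wpM2l (sqr_ge0 h) sq_g; rewrite hS; lra.
Qed.

Local Notation M := (nsteps A l1 lam).

Lemma nsteps_real : M%:R = (Num.ceil (64 * S / (lam - l1)))%:~R :> R.
Proof.
rewrite /nsteps natr_absz ger0_norm // ceil_ge0.
by apply: (@lt_trans _ _ 0); rewrite ?ltrN10 // divr_gt0 // mulr_gt0 // Sbar_gt0.
Qed.

Lemma nsteps_ge : 64 * S / (lam - l1) <= M%:R.
Proof. by rewrite nsteps_real ceil_ge. Qed.

Lemma nsteps_lt : M%:R < 64 * S / (lam - l1) + 1.
Proof.
by rewrite nsteps_real -ltrBlDr -[X in _ - X](mulr1z 1) -intrB ceilB1_lt.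
Qed.

Lemma nsteps_gt0 : (0 < M)%N.
Proof.
rewrite -(ltr0n R); apply: lt_le_trans nsteps_ge.
by rewrite divr_gt0 // mulr_gt0 // Sbar_gt0.
Qed.

Lemma svrg_expectE g :
  svrg_expect A l1 lam b x0 g
  = \sum_(1 <= m < M.+1) M%:R^-1 * iter m (avg (prow A) step) g x0.
Proof.
rewrite /svrg_expect exchange_big /= !big_nat; apply: eq_bigr => m /andP[_ mM].
rewrite -(@sum_tuple_foldl _ _ _ _ _ (sum_prow F_gt0) M) //.
rewrite mulr_sumr; apply: eq_bigr => w _.
by rewrite /svrg_iter -mulrA mulrCA.
Qed.

Lemma svrg_halves :
  svrg_expect A l1 lam b x0 (fun x => normB B (x - xs) ^+ 2)
  <= 2^-1 * normB B (x0 - xs) ^+ 2.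
Proof.
have -> : (fun x => normB B (x - xs) ^+ 2) = (fun x => qform B (x - xs)).
  by apply/funext => x; rewrite normB_sq // qform_Bmx_ge0.
rewrite normB_sq ?qform_Bmx_ge0 // svrg_expectE -mulr_sumr.
pose Q (x : 'cV[R]_d) := qform B (x - xs); rewrite -/Q.
pose V (x : 'cV[R]_d) := dotv (x - xs) (x - xs).
have p0 i : 0 <= prow A i by exact: prow_ge0.
(* The output is one of [x_1, ..., x_M], while telescoping starts at [x_0]: [M.+1] terms are summed
   and the one of index 0 is split off. *)
have := telescope_avg p0 (sum_prow F_gt0) M.+1 x0 avg_sq_dist.
rewrite -/Q -/V big_nat_recl // big_add1 /= -/(Q x0).
set T := \sum_(0 <= i < M) _.
have : 0 <= iter M.+1 (avg (prow A) step) V x0.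
  by apply: iter_avg_ge0 => // y; exact: dotvv_ge0.
rewrite /=; set v := avg _ _ _ _; move=> v0.
have Q0 : 0 <= Q x0 by exact: qform_Bmx_ge0.
have VQ : V x0 <= Q x0 / (lam - l1).
  by rewrite ler_pdivlMr // mulrC qform_Bmx_ge.
have M1 : 1 <= M%:R :> R by rewrite ler1n nsteps_gt0.
(* From [M >= 64 S / mu] and [h = 1 / (8 S)] follows [h M >= 8 / mu], hence [V x0 <= h M Q(x0) / 8]:
   the initial distance is small against the [7/8 h M Q(x0)] that halving allows. *)
have hM : 8 * (Q x0 / (lam - l1)) <= h * M%:R * Q x0.
  have := ler_wpM2r Q0 (ler_wpM2l (ltW eta_gt0) nsteps_ge).
  apply: le_trans; rewrite le_eqVlt; apply/orP; left; apply/eqP.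
  by rewrite /eta; field; rewrite !gt_eqF // Sbar_gt0.
move=> bound.
rewrite mulrC ler_pdivrMr ?(lt_le_trans ltr01) //.
rewrite -(ler_pM2l eta_gt0).
have hQ : 0 <= h * Q x0 by rewrite mulr_ge0 // ltW // eta_gt0.
have hQM : h * Q x0 <= h * M%:R * Q x0.
  by rewrite mulrAC ler_peMr.
rewrite -[M.+1%:R]natr1 -/(V x0) in bound; lra.
Qed.

End Convergence.

(** * Execution of the programs *)

Section Programs.
Variable R : realType.

Definition ticks (X : Type) (t : nat) (q : prog R X) : prog R X :=
  iter t (@Tick R X) q.

(** Stated as an equality of programs, so that value and cost are known together and a deterministic
    fragment can be rewritten inside a program that draws. *)
Definition runs (X : Type) (p : prog R X) (x : X) (t : nat) : Prop :=
  p = ticks t (Ret x).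

(** The remainder [q] is arbitrary and may contain draws; [runs_bind] is the case of a deterministic
    remainder. *)
Lemma bind_runs (X Y : Type) (p : prog R X) x t (k : X -> prog R Y) u q :
  runs p x t -> k x = ticks u q -> bind p k = ticks (t + u) q.
Proof.
move=> ->; elim: t => [|t IH] /= kx; first by rewrite kx.
by rewrite IH.
Qed.

Lemma runs_bind (X Y : Type) (p : prog R X) x t (k : X -> prog R Y) y u :
  runs p x t -> runs (k x) y u -> runs (bind p k) y (t + u).
Proof. exact: bind_runs. Qed.

Lemma op_runs (X : Type) (x : X) : runs (op R x) x 1.
Proof. by []. Qed.

Lemma foldP_runs (T X : Type) (f : X -> T -> prog R X) g c s x :
  (forall y e, runs (f y e) (g y e) (c e)) ->
  runs (foldP f s x) (foldl g x s) (\sum_(e <- s) (c e).+1)%N.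
Proof.
move=> fg; elim: s x => [|e s IH] x /=; first by rewrite big_nil.
by rewrite /runs big_cons addSn /= (bind_runs (fg x e) (IH _)).
Qed.

Lemma foldl_write d (w : 'I_d -> R) (s : seq 'I_d) (v : 'cV[R]_d) :
  foldl (fun (v : 'cV[R]_d) j => \col_k (if k == j then w j else v k 0)) v s
  = \col_k (if k \in s then w k else v k 0).
Proof.
elim: s v => [|j s IH] v /=; first by apply/matrixP => k l; rewrite ord1 mxE.
rewrite IH; apply/matrixP => k l; rewrite !mxE inE.
by case: (k \in s); rewrite ?orbT ?orbF //; case: eqP => // ->.
Qed.

(** The two extra operations per entry are the write and the loop overhead. *)
Lemma fillP_runs d (f : 'I_d -> prog R R) (v : 'cV[R]_d) c :
  (forall j, runs (f j) (v j 0) (c j)) ->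
  runs (fillP f) v (\sum_j (c j).+2)%N.
Proof.
move=> fv; rewrite /fillP.
have -> : v = foldl (fun (u : 'cV[R]_d) j => \col_k (if k == j then v j 0 else u k 0)) 0 (enum 'I_d).
  by rewrite foldl_write; apply/matrixP => k l; rewrite mxE mem_enum ord1.
have -> : (\sum_j (c j).+2 = \sum_(j <- enum 'I_d) (c j + 1).+1)%N.
  by rewrite big_enum; apply: eq_bigr => j _; rewrite addn1.
by apply: foldP_runs => u j; apply: (runs_bind (fv j)).
Qed.

Lemma fillP_const_runs d (f : 'I_d -> prog R R) (v : 'cV[R]_d) c :
  (forall j, runs (f j) (v j 0) c) -> runs (fillP f) v (d * c.+2).
Proof. by move/fillP_runs; rewrite sum_nat_const card_ord. Qed.

Lemma foldl_add (V : zmodType) (T : Type) (G : T -> V) s c :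
  foldl (fun c e => c + G e) c s = c + \sum_(e <- s) G e.
Proof.
by elim: s c => [|e s IH] c /=; rewrite ?big_nil ?addr0 // IH big_cons addrA.
Qed.

Lemma spdotP_runs d (s : seq ('I_d * R)) (u : 'cV[R]_d) :
  runs (spdotP s u) (\sum_(e <- s) e.2 * u e.1 0) (4 * size s).
Proof.
have -> : (4 * size s = \sum_(e <- s) 4)%N.
  by rewrite big_const_seq count_predT iter_addn_0.
rewrite -[\sum_(e <- s) _ * _]add0r -foldl_add.
by apply: foldP_runs => c e.
Qed.

(** An arbitrary list may repeat an index, in which case successive updates accumulate; hence the
    sum over all matching entries. *)
Lemma foldl_spsub d (c : R) (s : seq ('I_d * R)) (v : 'cV[R]_d) :
  foldl (fun (v : 'cV[R]_d) e => \col_k (if k == e.1 then v e.1 0 - c * e.2 else v k 0)) v s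
  = \col_k (v k 0 - c * \sum_(e <- s | e.1 == k) e.2).
Proof.
elim: s v => [|e s IH] v /=.
  by apply/matrixP => k l; rewrite ord1 mxE big_nil mulr0 subr0.
rewrite IH; apply/matrixP => k l; rewrite !mxE big_cons eq_sym.
by case: eqP => // ->; rewrite mulrDr opprD addrA.
Qed.

Lemma spsubP_runs d (c : R) (s : seq ('I_d * R)) (v : 'cV[R]_d) :
  runs (spsubP c s v) (\col_k (v k 0 - c * \sum_(e <- s | e.1 == k) e.2))
    (5 * size s).
Proof.
have -> : (5 * size s = \sum_(e <- s) 5)%N.
  by rewrite big_const_seq count_predT iter_addn_0.
by rewrite -foldl_spsub; apply: foldP_runs => u e.
Qed.

Lemma time_ticks (X : Type) t (q : prog R X) : time (ticks t q) = (t + time q)%N.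
Proof. by elim: t => //= t ->. Qed.

Lemma expect_ticks (X : Type) (g : X -> R) t q :
  expect g (ticks t q) = expect g q.
Proof. by elim: t. Qed.

Lemma expect_Draw (X : Type) (g : X -> R) N (w : 'I_N -> R) q :
  expect g (Draw w q) = \sum_i w i * expect g (q i).
Proof. by []. Qed.

Lemma time_bind_uniformP (X : Type) N (k : 'I_N -> prog R X) :
  time (bind (uniformP R N) k) = (\max_(i < N) time (k i)).+1.
Proof. by []. Qed.

Lemma expect_bind (X Y : Type) (g : Y -> R) (p : prog R X) k :
  expect g (bind p k) = expect (fun x => expect g (k x)) p.
Proof.
by elim: p => //= N w q IH; apply: eq_bigr => i _; rewrite IH.
Qed.

Lemma time_bind_le (X Y : Type) (p : prog R X) (k : X -> prog R Y) c :
  (forall x, time (k x) <= c)%N -> (time (bind p k) <= time p + c)%N.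
Proof.
move=> kc; elim: p => [x|q IH|N w q IH] /=; first by rewrite add0n.
  by rewrite addSn ltnS.
rewrite addSn ltnS; apply/bigmax_leqP => i _.
by apply: leq_trans (IH i) _; rewrite leq_add2r leq_bigmax.
Qed.

Lemma time_repeatP_le (X : Type) (f : X -> prog R X) c k x :
  (forall y, time (f y) <= c)%N -> (time (repeatP f k x) <= k * c.+1)%N.
Proof.
move=> fc; elim: k x => [|k IH] x //=.
rewrite mulSn addSn ltnS; apply: leq_trans (time_bind_le _ IH) _.
by rewrite leq_add2r.
Qed.

Lemma expect_repeatP (X : Type) (f : X -> prog R X) n (p : 'I_n -> R) step :
  (forall g x, expect g (f x) = avg p step g x) ->
  forall g k x, expect g (repeatP f k x) = iter k (avg p step) g x.
Proof.
move=> fE g; elim=> [|k IH] x //=.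
by rewrite expect_bind fE; apply: eq_bigr => i _; rewrite IH.
Qed.

End Programs.

(** * Value and exact cost of each phase of the algorithm *)

Section Algorithm.
Variables (R : realType) (n d : nat) (A : 'M[R]_(n, d)).
Local Notation a := (arow A).
Local Notation r i := (size (sprow A i)).

Lemma big_sprow (V : nmodType) (G : 'I_d * R -> V) (P : pred 'I_d) i :
  \sum_(e <- sprow A i | P e.1) G e
  = \sum_(j | P j && (A i j != 0)) G (j, A i j).
Proof.
rewrite /sprow big_map big_filter_cond big_enum_cond /=.
by apply: eq_bigl => j; rewrite andbC.
Qed.

Lemma sum_sprow_mul i (u : 'cV[R]_d) :
  \sum_(e <- sprow A i) e.2 * u e.1 0 = dotv (a i) u.
Proof.
rewrite (big_sprow _ predT) dotvE big_mkcond; apply: eq_bigr => j _ /=.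
by rewrite !mxE; case: eqP => //= ->; rewrite mul0r.
Qed.

Lemma sum_sprow_sq i : \sum_(e <- sprow A i) e.2 * e.2 = dotv (a i) (a i).
Proof.
rewrite -sum_sprow_mul !(big_sprow _ predT); apply: eq_bigr => j _.
by rewrite /= !mxE.
Qed.

(** Column [k] occurs at most once in the sparse row, and is absent exactly when the entry is 0,
    which is then the value of the empty sum. *)
Lemma sum_sprow_at i k : \sum_(e <- sprow A i | e.1 == k) e.2 = a i k 0.
Proof.
rewrite (big_sprow (fun e => e.2) (pred1 k)) !mxE /=.
have [A0|A0] := eqVneq (A i k) 0.
  by rewrite big1 ?A0 // => j /andP[/eqP -> ]; rewrite A0 eqxx.
rewrite (big_pred1 k) // => j /=.
by have [->|] := eqVneq j k; rewrite ?A0.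
Qed.

Lemma size_sprow i : (r i = \sum_j (A i j != 0)%R)%N.
Proof.
rewrite /sprow size_map -sum1_size big_filter big_enum_cond /= big_mkcond /=.
by apply: eq_bigr => j _; case: (A i j != 0).
Qed.

Lemma size_sprow_le i : (r i <= d)%N.
Proof.
rewrite size_sprow -[X in (_ <= X)%N]card_ord -sum1_card.
by apply: leq_sum => j _; case: (A i j != 0).
Qed.

Lemma size_sprow_gt0 i : row i A != 0 -> (0 < r i)%N.
Proof.
apply: contraNT; rewrite -leqNgt leqn0 size_sprow sum_nat_eq0 => /forallP Ai.
apply/eqP/matrixP => k j; rewrite !mxE.
by have := Ai j; rewrite /= eqb0 negbK => /eqP.
Qed.

Lemma nnzE : (nnz A = \sum_i r i)%N.
Proof.
under eq_bigr do rewrite size_sprow.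
rewrite pair_big /= /nnz -sum1_card [LHS]big_mkcond /=.
by apply: eq_bigr => -[i j] _ /=; rewrite inE /=; case: (A i j != 0).
Qed.

Lemma spsubP_sprow_runs (c : R) i (v : 'cV[R]_d) :
  runs (spsubP c (sprow A i) v) (v - c *: a i) (5 * r i).
Proof.
rewrite /runs spsubP_runs; congr (ticks _ (Ret _)); apply/matrixP => k l.
by rewrite ord1 mxE sum_sprow_at !mxE.
Qed.

Lemma fgradP_runs lam b x0 :
  runs (fgradP (sprow A) lam b x0) (Bmx A lam *m x0 - b)
    (d * 6 + \sum_i (9 * r i).+1)%N.
Proof.
rewrite /fgradP.
apply: (runs_bind (x := lam *: x0 - b)).
  by apply: (fillP_const_runs (c := 4)) => j; rewrite /runs !mxE.
have -> : Bmx A lam *m x0 - b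
  = foldl (fun g i => g - dotv (a i) x0 *: a i) (lam *: x0 - b) (enum 'I_n).
  by rewrite foldl_add big_enum sumrN -Sigma_mul Bmx_mul addrAC.
rewrite -(big_enum _ _ _ (fun i => (9 * r i).+1)).
apply: foldP_runs => g i.
rewrite (_ : 9 * _ = 4 * r i + 5 * r i)%N; last by rewrite -mulnDl.
apply: (runs_bind (spdotP_runs _ _)); rewrite sum_sprow_mul.
exact: spsubP_sprow_runs.
Qed.

(** The update for an arbitrary stored vector [g]; when [g] is the full gradient [B x0 - b] and [h]
    is [eta], it is [svrg_step]. *)
Definition sampled_step lam x0 h g (x : 'cV[R]_d) (i : 'I_n) : 'cV[R]_d :=
  x - h *: (sgrad A lam i (x - x0) + g).

Lemma stepP_ticks lam x0 (p : 'cV[R]_n) h g x :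
  (forall i, p i 0 = prow A i) ->
  stepP (sprow A) lam x0 p h g x
  = Draw (fun i => p i 0) (fun i => ticks (17 * d + 9 * r i + 2)
      (Ret (sampled_step lam x0 h g x i))).
Proof.
move=> pE; rewrite /stepP /sampleP /=; congr Draw; apply/funext => i.
rewrite (_ : 17 * d + _ + 2 = d * 5 + (4 * r i + (1 + (1 + (d * 6 + (5 * r i + d * 6))))))%N;
  last by lia.
pose u := x - x0.
apply: (runs_bind (x := u)).
  by apply: (fillP_const_runs (c := 3)) => j; rewrite /runs /u !mxE.
apply: (runs_bind (spdotP_runs _ _)); rewrite sum_sprow_mul.
apply: (runs_bind (op_runs _ _)); apply: (runs_bind (op_runs _ _)); rewrite pE.
apply: (runs_bind (x := lam *: u + g)).
  by apply: (fillP_const_runs (c := 4)) => j; rewrite /runs !mxE.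
apply: (runs_bind (spsubP_sprow_runs _ _ _)).
apply: (fillP_const_runs (c := 4)) => j.
rewrite /sampled_step; congr (Tick (Tick (Tick (Tick (Ret _))))).
by rewrite /sgrad !mxE addrAC.
Qed.

Lemma svrgP_ticks l1 lam b x0 :
  svrgP (sprow A) l1 lam b x0
  = ticks (12 * nnz A + 11 * n + 9 + nsteps A l1 lam + 6 * d)
      (bind (uniformP R (nsteps A l1 lam)) (fun m =>
        repeatP (stepP (sprow A) lam x0 (\col_i prow A i) (eta A l1 lam)
                   (Bmx A lam *m x0 - b)) m.+1 x0)).
Proof.
(* The cost is regrouped by phase: row norms, their sum, probabilities, alias table, eight scalar
   operations, ceiling, full gradient. The final 0 stands before the random part. *)
rewrite (_ : 12 * _ + _ + _ + _ + _
  = (3 * nnz A + n * 2) + (n * 3 + (n * 4 + (n + (1 + (1 + (1 + (1 + (1 + (1 +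
    (1 + (1 + ((nsteps A l1 lam).+1 + ((d * 6 + (9 * nnz A + n)) + 0
    ))))))))))))))%N; last by lia.
rewrite /svrgP.
apply: (bind_runs (x := \col_i dotv (a i) (a i))).
  rewrite nnzE big_distrr /= -[n in (n * 2)%N]card_ord -sum_nat_const -big_split /=.
  under eq_bigr do rewrite addn2.
  apply: fillP_runs => i; rewrite mxE -sum_sprow_sq -[\sum_(e <- _) _]add0r.
  rewrite -foldl_add (_ : 3 * r i = \sum_(e <- sprow A i) 3)%N; last first.
    by rewrite big_const_seq count_predT iter_addn_0.
  by apply: foldP_runs => c e.
apply: (bind_runs (x := normF A ^+ 2)).
  rewrite normF_sq -[n in (n * 3)%N]card_ord -sum_nat_const -[\sum_i dotv _ _]add0r.
  rewrite -!big_enum -foldl_add.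
  by apply: foldP_runs => c i; rewrite /runs /readP mxE.
apply: (bind_runs (x := \col_i prow A i)).
  by apply: (fillP_const_runs (c := 2)) => i; rewrite /runs /readP !mxE prowE.
apply: (bind_runs (x := \col_i prow A i)) => //.
do 8 apply: (bind_runs (op_runs _ _)).
apply: (bind_runs (x := nsteps A l1 lam)); first by [].
apply: (bind_runs (x := Bmx A lam *m x0 - b)).
  have -> : (9 * nnz A + n = \sum_i (9 * r i).+1)%N.
    rewrite nnzE big_distrr /= -[X in (_ + X)%N]card_ord -sum1_card -big_split.
    by apply: eq_bigr => i _; rewrite /= addn1.
  exact: fgradP_runs.
by rewrite div1r.
Qed.

End Algorithm.

(** * Law of one step and worst-case operation count *)

Section AlgorithmBounds.
Variables (R : realType) (n d : nat) (A : 'M[R]_(n, d)) (l1 lam : R).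
Variables (b x0 : 'cV[R]_d).
Local Notation M := (nsteps A l1 lam).

Lemma expect_stepP g x : (forall i, prow A i != 0) ->
  expect g (stepP (sprow A) lam x0 (\col_i prow A i) (eta A l1 lam)
              (Bmx A lam *m x0 - b) x)
  = avg (prow A) (svrg_step A l1 lam b x0) g x.
Proof.
move=> p0; rewrite stepP_ticks => [|i]; last by rewrite mxE.
rewrite expect_Draw; apply: eq_bigr => i _; rewrite expect_ticks mxE /=; congr (_ * g _).
by rewrite svrg_stepE.
Qed.

(** Nonzero rows give [n <= nnz A], and positivity of [M] and [d] bounds both by [M * d]; additive
    constants are absorbed because [nnz A] is positive. *)
Lemma time_svrgP : (forall i, row i A != 0) ->
  (0 < n)%N -> (0 < d)%N -> (0 < M)%N ->
  (time (svrgP (sprow A) l1 lam b x0) <= 40 * (nnz A + M * d))%N.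
Proof.
move=> r0 n0 d0 M0; rewrite svrgP_ticks time_ticks.
have n_nnz : (n <= nnz A)%N.
  rewrite nnzE -[X in (X <= _)%N]card_ord -sum1_card.
  by apply: leq_sum => i _; exact: size_sprow_gt0.
(* One draw plus [17 d + 9 r + 2] operations, where a row has [r <= d] nonzero entries. *)
have time_step x : (time (stepP (sprow A) lam x0 (\col_i prow A i) (eta A l1 lam)
    (Bmx A lam *m x0 - b) x) <= 26 * d + 3)%N.
  rewrite stepP_ticks => [|i]; last by rewrite mxE.
  rewrite /= addnS ltnS; apply/bigmax_leqP => i _; rewrite time_ticks /=.
  by have := size_sprow_le A i; lia.
have time_loop : (time (bind (uniformP R M) (fun m =>
    repeatP (stepP (sprow A) lam x0 (\col_i prow A i) (eta A l1 lam)
      (Bmx A lam *m x0 - b)) m.+1 x0)) <= (M * (26 * d + 3).+1).+1)%N.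
  rewrite time_bind_uniformP ltnS; apply/bigmax_leqP => m _.
  apply: leq_trans (time_repeatP_le _ _ time_step) _.
  by rewrite leq_mul2r ltn_ord orbT.
have Md : (M <= M * d)%N by rewrite leq_pmulr.
have dM : (d <= M * d)%N by rewrite leq_pmull.
have dist : (M * (26 * d + 3).+1 = 26 * (M * d) + 4 * M)%N by lia.
rewrite dist in time_loop.
apply: leq_trans (leq_add (leqnn _) time_loop) _; lia.
Qed.

End AlgorithmBounds.

(** * Eigenvalues of [Sigma A] and their relation to the norms of [A] *)

Section SpectralFacts.
Variables (R : realType) (n d : nat) (A : 'M[R]_(n, d)) (s : seq R).
Hypothesis sA : eigenvalues_desc (Sigma A) s.

Lemma eigenvalue_Sigma_ge0 (l : R) : eigenvalue (Sigma A) l -> 0 <= l.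
Proof.
case/(eigenvalue_colP (Sigma_sym A)) => v Av v0.
have := qform_Sigma_ge0 A v; rewrite qformE Av dotvZr.
by rewrite pmulr_lge0 // dotvv_gt0.
Qed.

Lemma eigenvalues_Sigma_ge0 k : 0 <= s`_k.
Proof.
(* Beyond the end of [s] the default value is 0, so the second eigenvalue counts as 0 when
   [d = 1]. *)
have [ks|ks] := ltnP k (size s); last by rewrite nth_default.
by apply: eigenvalue_Sigma_ge0; rewrite (eigenvalues_desc_mem _ sA) mem_nth.
Qed.

(** Division by zero gives 0, so a zero top eigenvalue would make the gap 0. *)
Lemma gap_gt0_l1 : 0 < gap s`_0 s`_1 -> 0 < s`_0.
Proof.
rewrite [0 < s`_0]lt_def eigenvalues_Sigma_ge0 andbT; apply: contraTN => /eqP.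
by rewrite /gap => ->; rewrite invr0 mulr0 ltxx.
Qed.

Lemma gap_le1 : 0 < gap s`_0 s`_1 -> gap s`_0 s`_1 <= 1.
Proof.
move=> /gap_gt0_l1 l0; rewrite /gap ler_pdivrMr // mul1r gerBl.
exact: eigenvalues_Sigma_ge0.
Qed.

Lemma qform_Sigma_le x : qform (Sigma A) x <= s`_0 * dotv x x.
Proof.
apply: (qform_le_max_eigenvalue _ (Sigma_sym A)) => l.
exact: eigenvalues_desc_max.
Qed.

Lemma top_eigenvector : 0 < s`_0 ->
  exists2 v : 'cV[R]_d, Sigma A *m v = s`_0 *: v & v != 0.
Proof.
move=> l0; apply: eigenvalue_colP; first exact: Sigma_sym.
rewrite (eigenvalues_desc_mem _ sA) mem_nth //.
by case: s l0 => //=; rewrite ltxx.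
Qed.

(** The row-by-row Cauchy-Schwarz bound is evaluated at a top eigenvector. *)
Lemma l1_le_normF : 0 < s`_0 -> s`_0 <= normF A ^+ 2.
Proof.
case/top_eigenvector => v Av /dotvv_gt0 v0.
have := qform_Sigma_le_normF A v; rewrite qformE Av dotvZr.
by rewrite ler_pM2r.
Qed.

(** As [|A x|^2 = x . Sigma x], the supremum is attained at a normalized top eigenvector. Thus the
    stable rank is [|A|_F^2] divided by the top eigenvalue. *)
Lemma opnorm2_sq : 0 < s`_0 -> opnorm2 A ^+ 2 = s`_0.
Proof.
move=> l0; have [v Av /dotvv_gt0 v0] := top_eigenvector l0.
suff -> : opnorm2 A = Num.sqrt s`_0 by rewrite sqr_sqrtr // ltW.
set E := [set norm2 (A *m x) | x in [set x : 'cV[R]_d | norm2 x = 1]].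
have ubE : ubound E (Num.sqrt s`_0).
  move=> _ [x /= x1 <-]; rewrite norm2_sqrt -qform_Sigma_norm ler_wsqrtr //.
  by have := qform_Sigma_le x; rewrite -norm2_sq x1 expr1n mulr1.
have topE : E (Num.sqrt s`_0).
  pose c := (norm2 v)^-1; exists (c *: v) => /=.
    rewrite norm2_sqrt dotvZl dotvZr mulrA -expr2 exprVn norm2_sq.
    by rewrite mulVf ?sqrtr1 // gt_eqF.
  rewrite norm2_sqrt -qform_Sigma_norm qformE -scalemxAr Av !(dotvZl, dotvZr).
  rewrite mulrCA mulrA -expr2 mulrCA exprVn norm2_sq.
  by rewrite mulVf ?mulr1 // gt_eqF.
apply/le_anti/andP; split.
  by apply: ge_sup => //; exists (Num.sqrt s`_0).
by apply: ub_le_sup => //; exists (Num.sqrt s`_0).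
Qed.

Lemma Bmx_unit lam : s`_0 < lam -> Bmx A lam \in unitmx.
Proof.
move=> l_lam; apply: unitmx_not_eigenvalue; apply/negP.
by move/(eigenvalues_desc_max sA); rewrite leNgt l_lam.
Qed.

End SpectralFacts.

(** * Error bound, law of the output and running time combined *)

Theorem theorem4p4 (R : realType) :
  exists C : R, forall (n d : nat) (A : 'M[R]_(n, d)) (s : seq R)
    (lam : R) (b x0 : 'cV[R]_d),
  let l1 := s`_0 in
  let l2 := s`_1 in
  (forall i : 'I_n, row i A != 0) ->
  eigenvalues_desc (Sigma A) s ->
  0 < gap l1 l2 ->
  (1 + gap l1 l2 / 150) * l1 < lam ->
  lam <= (1 + gap l1 l2 / 100) * l1 ->
  [/\ svrg_expect A l1 lam b x0
        (fun x => normB (Bmx A lam) (x - xstar A lam b) ^+ 2)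
        <= 2^-1 * normB (Bmx A lam) (x0 - xstar A lam b) ^+ 2,
      (forall g : 'cV[R]_d -> R,
        expect g (svrgP (sprow A) l1 lam b x0)
        = svrg_expect A l1 lam b x0 g)
    & (time (svrgP (sprow A) l1 lam b x0))%:R
        <= C * ((nnz A)%:R + d%:R * srank A / gap l1 l2 ^+ 2)].
Proof.
(* 40 comes from the operation count, [129 = 64 * 2 + 1] from the number of steps with its rounding,
   and [150 ^+ 2] from [mu >= gap * l1 / 150]. *)
exists (40 * (129 * 150 ^+ 2)) => n d A s lam b x0 l1 l2 r0 sA gap0 lam_lb lam_ub.
have l1_gt0 : 0 < l1 := gap_gt0_l1 sA gap0.
have gap1 : gap l1 l2 <= 1 := gap_le1 sA gap0.
have F_ge := l1_le_normF sA l1_gt0; rewrite -/l1 in F_ge.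
have op_sq := opnorm2_sq sA l1_gt0; rewrite -/l1 in op_sq.
have Sle := qform_Sigma_le sA; rewrite -/l1 in Sle.
move: (gap l1 l2) gap0 gap1 lam_lb lam_ub => gp gp0 gp1 lam_lb lam_ub.
have gl0 : 0 < gp * l1 by rewrite mulr_gt0.
have gl1 : gp * l1 <= l1 by rewrite ger_pMl.
have mu_ge : gp * l1 / 150 <= lam - l1 by lra.
have l1_lam : l1 < lam by lra.
have lam_le : lam <= 2 * l1 by lra.
have mu_le : lam - l1 <= l1 by lra.
have mu_gt0 : 0 < lam - l1 by lra.
have B_unit := Bmx_unit sA l1_lam.
have F_gt0 : 0 < normF A ^+ 2 by exact: lt_le_trans F_ge.
have p0 i : prow A i != 0 by rewrite gt_eqF // prow_gt0.
split.
- exact: svrg_halves.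
- move=> g; rewrite svrgP_ticks expect_ticks expect_bind /=.
  (* The program draws [m] from 0 to [M - 1] and makes [m.+1] steps, so the uniform sum over 1 to
     [M] is shifted by one. *)
  rewrite svrg_expectE // big_add1 /= big_mkord; apply: eq_bigr => m _.
  congr (_ * _).
  exact: (expect_repeatP (fun g x => expect_stepP l1 lam b x0 g x p0) g m.+1).
have n0 : (0 < n)%N.
  case: n A r0 sA F_ge {op_sq Sle B_unit p0 F_gt0} => // A _ _.
  by rewrite normF_sq big_ord0 leNgt l1_gt0.
have d0 : (0 < d)%N.
  rewrite -(eigenvalues_desc_size sA).
  by move: l1_gt0; rewrite /l1; case: (s) => //=; rewrite ltxx.
have M0 : (0 < nsteps A l1 lam)%N by exact: nsteps_gt0.
have M_le : (nsteps A l1 lam)%:R <= 129 * 150 ^+ 2 * (srank A / gp ^+ 2) :> R.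
  have M_lt := nsteps_lt l1_gt0 l1_lam F_ge.
  rewrite /srank op_sq; move: M_lt; rewrite /Sbar.
  move: (normF A ^+ 2) F_ge F_gt0 => F F_ge F_gt0.
  move: (nsteps A l1 lam)%:R (lam - l1) mu_ge mu_le mu_gt0.
  move=> M m mu_ge mu_le mu_gt0 M_lt.
  (* Since [m <= l1 <= F], this ratio is at least 1 and absorbs the [+ 1] due to the ceiling. *)
  have k1 : 1 <= l1 * F / m ^+ 2.
    rewrite ler_pdivlMr ?exprn_gt0 // mul1r expr2.
    by apply: ler_pM => //; [exact: ltW|exact: ltW|exact: le_trans F_ge].
  (* The lower bound on [m = lam - l1] enters squared and turns the ratio into [srank A / gap^2], up
     to the constant. *)
  have k2 : l1 * F / m ^+ 2 <= 150 ^+ 2 * (F / l1 / gp ^+ 2).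
    rewrite ler_pdivrMr ?exprn_gt0 //.
    have -> : l1 * F = F / l1 / gp ^+ 2 * (gp * l1) ^+ 2.
      by field; rewrite !gt_eqF.
    have -> : 150 ^+ 2 * (F / l1 / gp ^+ 2) * m ^+ 2
              = F / l1 / gp ^+ 2 * (150 * m) ^+ 2 by ring.
    apply: ler_wpM2l; first by rewrite !divr_ge0 ?exprn_ge0 // ltW.
    rewrite ler_pXn2r ?nnegrE //; [lra|exact: ltW|].
    by rewrite mulr_ge0 // ltW.
  have -> : 129 * 150 ^+ 2 * (F / l1 / gp ^+ 2)
            = 129 * (150 ^+ 2 * (F / l1 / gp ^+ 2)) by rewrite -mulrA.
  have M_ltk : M < 128 * (l1 * F / m ^+ 2) + 1.
    apply: (lt_le_trans M_lt); rewrite le_eqVlt; apply/orP; left; apply/eqP.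
    by field; rewrite gt_eqF.
  lra.
have := time_svrgP b x0 r0 n0 d0 M0; rewrite -(ler_nat R) => /le_trans; apply.
rewrite natrM natrD natrM -[leRHS]mulrA ler_pM2l // mulrDr.
have le1c : 1 <= 129 * 150 ^+ 2 :> R by rewrite -natrX -natrM ler1n.
apply: lerD; first by rewrite ler_peMl.
by rewrite [leLHS]mulrC -(mulrA d%:R) [leRHS]mulrCA ler_wpM2l.
Qed.
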